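(* Let $n\ge 4$ and let $O$ be an order ideal of the type $(D_n,1)$ poset $Q$ described in the context. An $\oplus$-diagram $D$ of shape $O$ is a $\Gamma$-diagram if and only if for every box $c\in O$ greater than both middle boxes with $D(c)=0$, and every box $b$ covered by $c$, it is not the case that both $D(b)=+$ and $D(b')=+$, where $b'$ is the conjugate of $b$.
   Context: $W$: Weyl group of type $D_n$ with simple reflections $s_1,\dots,s_n$, where $s_is_{i+1}$ ($i\le n-2$) and $s_{n-2}s_n$ have order 3 and all other pairs commute; Bruhat order $<$. $Q$ has $2n-2$ boxes $b_1,\dots,b_{n-2},m_{n-1},m_n,b'_{n-2},\dots,b'_1$ with labels $s_{b_k}=s_{b'_k}=s_k$, $s_{m_{n-1}}=s_{n-1}$, $s_{m_n}=s_n$, and cover relations $b_1\lessdot b_2\lessdot\dots\lessdot b_{n-2}$, $b_{n-2}\lessdot m_{n-1}$, $b_{n-2}\lessdot m_n$, $m_{n-1}\lessdot b'_{n-2}$, $m_n\lessdot b'_{n-2}$, $b'_{n-2}\lessdot b'_{n-3}\lessdot\dots\lessdot b'_1$. The middle boxes are $m_{n-1},m_n$; conjugates: $b_k\leftrightarrow b'_k$ and $m_{n-1}\leftrightarrow m_n$. Order ideals are down-closed subsets. An $\oplus$-diagram of shape $O$ is a map $D:O\to\{0,+\}$. For a linear extension $e_1,\dots,e_m$ of $O$ set $s_{i_t}:=s_{e_{m+1-t}}$, $t_t=s_{i_t}$ if $D(e_{m+1-t})=0$ and $t_t=1$ otherwise, $v_{(0)}=1$, $v_{(k)}=t_1\cdots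 t_k$. $D$ is a $\Gamma$-diagram if $v_{(k-1)}<v_{(k-1)}s_{i_k}$ for all $k$ (independent of the linear extension). *)

(* Defs.v *)
From HB Require Import structures.
From mathcomp Require Import all_boot all_fingroup cyclic zify.

Set Implicit Arguments.
Unset Strict Implicit.
Unset Printing Implicit Defensive.

Local Open Scope nat_scope.
Local Open Scope group_scope.

(* S ^+ k is the set of products of k elements of S.  The search bound #|gT| is
   harmless: see word_length_mem and word_length_min. *)
Definition word_length (gT : finGroupType) (S : {set gT}) (w : gT) : nat :=
  find (fun k => w \in S ^+ k) (iota 0 #|gT|).

Definition reflections (gT : finGroupType) (S : {set gT}) : {set gT} :=
  class_support S <<S>>.

Definition bruhat_step (gT : finGroupType) (S : {set gT}) : rel gT :=
  fun u v => [exists t in reflections S,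
    [&& u \in <<S>>, v == u * t & word_length S u < word_length S v]].

Definition bruhat_le (gT : finGroupType) (S : {set gT}) : rel gT :=
  connect (bruhat_step S).

Definition bruhat_lt (gT : finGroupType) (S : {set gT}) : rel gT :=
  fun u v => (u != v) && bruhat_le S u v.

Lemma expg_wordP (gT : finGroupType) (S : {set gT}) (k : nat) (w : gT) :
  reflect (exists c : seq gT, [/\ size c = k, all [in S] c & w = \prod_(x <- c) x])
          (w \in S ^+ k).
Proof.
apply: (iffP idP) => [|[c [<- cS ->]]].
  elim: k w => [|k IHk] w; first by rewrite expg0 => /set1P->; exists [::]; rewrite big_nil.
  rewrite expgS => /mulsgP[x y xS /IHk[c [ck cS ->]] ->].
  by exists (x :: c); rewrite big_cons /= ck xS cS.
elim: c cS => [|x c IHc] /= => [_|/andP[xS /IHc cS]].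
  by rewrite big_nil expg0 set11.
by rewrite big_cons expgS mem_mulg.
Qed.

Lemma word_length_min (gT : finGroupType) (S : {set gT}) (w : gT) (k : nat) :
  w \in S ^+ k -> word_length S w <= k.
Proof.
move=> wk; rewrite leqNgt; apply/negP => lt_k.
have := before_find 0 lt_k; rewrite nth_iota ?add0n ?wk //.
by apply: leq_trans lt_k _; rewrite -[X in _ <= X](size_iota 0) find_size.
Qed.

Lemma word_length_mem (gT : finGroupType) (S : {set gT}) (w : gT) :
  w \in <<S>> -> w \in S ^+ word_length S w.
Proof.
move=> wS; suff h: has (fun k => w \in S ^+ k) (iota 0 #|gT|).
  have := nth_find 0 h; rewrite -/(word_length S w) nth_iota //.
  by rewrite -[X in _ < X](size_iota 0) -has_find.
have exk : exists k, w \in S ^+ k.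
  have [k [c cS ->]] := gen_prodgP wS.
  exists k; apply/expg_wordP; exists (codom c); split.
  - by rewrite size_codom card_ord.
  - by apply/allP=> _ /codomP[i ->]; apply: cS.
  - by rewrite big_map enumT.
case: (ex_minnP exk) => k wk kmin.
apply/hasP; exists k => //; rewrite mem_iota /= add0n ltnNge; apply/negP => le_k.
have /expg_wordP[c [ck cS def_w]] := wk.
pose P (j : 'I_k.+1) : gT := \prod_(x <- take j c) x.
have/injectivePn[i [j neq_ij eqP]] : ~~ injectiveb P.
  apply/negP => /injectiveP/leq_card; rewrite card_ord => /leq_trans/(_ le_k).
  by rewrite ltnn.
wlog lt_ij : i j neq_ij eqP / i < j.
  move=> H; case: (ltngtP i j) => [|lt_ji|/val_inj eq_ij]; first exact: H.
    by apply: (H j i) => //; rewrite eq_sym.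
  by rewrite eq_ij eqxx in neq_ij.
suff /kmin : w \in S ^+ (i + (k - j)).
  have := ltn_ord j; rewrite ltnS => le_jk.
  by rewrite leqNgt -[X in _ < X](subnKC le_jk) ltn_add2r lt_ij.
apply/expg_wordP; exists (take i c ++ drop j c); split.
- by rewrite size_cat size_drop size_take_min ck (minn_idPl (ltn_ord i : i <= k)).
- rewrite all_cat; apply/andP; split; apply/allP=> x.
    by move/mem_take; apply: (allP cS).
  by move/mem_drop; apply: (allP cS).
by rewrite big_cat -/(P i) eqP /P -big_cat cat_take_drop.
Qed.

(* W(D_n) is <<simple_reflections n>>, the group of even-signed permutations.
   The point (i, b) stands for the vector (-1)^b e_(i+1). *)
Notation signed_point n := ('I_n * bool)%type.

(* For i != j, the reflection in the root e_(i+1) - (-1)^c e_(j+1). *)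
Definition root_reflection (n : nat) (i j : 'I_n) (c : bool) :
    {perm signed_point n} :=
  tperm (i, false) (j, c) * tperm (i, true) (j, ~~ c).

(* s_k for 1 <= k <= n: s_k is the reflection in e_k - e_(k+1) if k < n, and s_n
   the reflection in e_(n-1) + e_n.  Other values of k are not used. *)
Definition simple_reflection (n k : nat) : {perm signed_point n} :=
  if insub k.-1 is Some i then
    if k < n then root_reflection i (ordS i) false
    else root_reflection (ord_pred i) i true
  else 1.

Definition simple_reflections (n : nat) : {set {perm signed_point n}} :=
  [set simple_reflection n i.+1 | i : 'I_n].

(* Indices are shifted by one: Lower i is b_(i+1) and Upper i is b'_(i+1), while
   MidA is m_(n-1) and MidB is m_n. *)
Inductive box (n : nat) : Type :=
  | Lower of 'I_n.-2 | MidA | MidB | Upper of 'I_n.-2.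
Arguments MidA {n}.
Arguments MidB {n}.

Definition box_code (n : nat) (x : box n) : 'I_n.-2 + bool + 'I_n.-2 :=
  match x with
  | Lower i => inl (inl i) | MidA => inl (inr false)
  | MidB => inl (inr true) | Upper i => inr i
  end.

Definition box_decode (n : nat) (c : 'I_n.-2 + bool + 'I_n.-2) : box n :=
  match c with
  | inl (inl i) => Lower i | inl (inr false) => MidA
  | inl (inr true) => MidB | inr i => Upper i
  end.

Lemma box_codeK (n : nat) : cancel (@box_code n) (@box_decode n).
Proof. by case. Qed.

HB.instance Definition _ (n : nat) :=
  Finite.copy (box n) (can_type (@box_codeK n)).

(* The k such that s_x = s_k. *)
Definition label (n : nat) (x : box n) : nat :=
  match x with
  | Lower i => i.+1 | MidA => n.-1 | MidB => n | Upper i => i.+1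
  end.

Definition box_conj (n : nat) (x : box n) : box n :=
  match x with
  | Lower i => Upper i | MidA => MidB | MidB => MidA | Upper i => Lower i
  end.

Definition coverQ (n : nat) : rel (box n) := fun x y =>
  match x, y with
  | Lower i, Lower j => j == i.+1 :> nat
  | Lower i, (MidA | MidB) => i.+1 == n.-2
  | (MidA | MidB), Upper j => j.+1 == n.-2
  | Upper i, Upper j => i == j.+1 :> nat
  | _, _ => false
  end.

Definition leQ (n : nat) : rel (box n) := connect (@coverQ n).

Definition ltQ (n : nat) : rel (box n) := fun x y => (x != y) && leQ x y.

Definition order_ideal (n : nat) (O : {set box n}) : Prop :=
  forall x y : box n, leQ x y -> y \in O -> x \in O.

Inductive entry : Type := Zero | Plus.

Notation boxes_of O := {x | x \in O}.

Definition oplus_diagram (n : nat) (O : {set box n}) : Type :=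
  boxes_of O -> entry.

Definition linear_extension (n : nat) (O : {set box n}) (e : seq (boxes_of O)) :
    Prop :=
  [/\ uniq e, forall x, x \in e
    & forall x y, ltQ (val x) (val y) -> index x e < index y e].

(* The sequence s_(i_1), ..., s_(i_m). *)
Definition reading_word (n : nat) (O : {set box n}) (e : seq (boxes_of O)) :
    seq {perm signed_point n} :=
  [seq simple_reflection n (label (val x)) | x <- rev e].

(* The sequence t_1, ..., t_m. *)
Definition diagram_factors (n : nat) (O : {set box n}) (D : oplus_diagram O)
    (e : seq (boxes_of O)) : seq {perm signed_point n} :=
  [seq if D x is Zero then simple_reflection n (label (val x)) else 1
     | x <- rev e].

(* v_(k) = t_1 ... t_k *)
Definition partial_product (n : nat) (O : {set box n}) (D : oplus_diagram O)
    (e : seq (boxes_of O)) (k : nat) : {perm signed_point n} :=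
  \prod_(t <- take k (diagram_factors D e)) t.

(* The condition v_(k-1) < v_(k-1) s_(i_k) with k shifted by one.  It does not
   depend on the linear extension e used to read D. *)
Definition gamma_diagram (n : nat) (O : {set box n}) (e : seq (boxes_of O))
    (D : oplus_diagram O) : Prop :=
  forall k, k < size e ->
    bruhat_lt (simple_reflections n) (partial_product D e k)
              (partial_product D e k * nth 1 (reading_word e) k).


(* The simple reflections satisfy the Coxeter relations of type D_n. *)

Lemma root_reflectionE (n : nat) (i j : 'I_n) (c : bool) (x : signed_point n) :
  i != j ->
  root_reflection i j c x =
    if x.1 == i then (j, x.2 (+) c) else if x.1 == j then (i, x.2 (+) c) else x.
Proof.
move=> neq_ij; have neq_ji : j == i = false by rewrite eq_sym (negPf neq_ij).
have pE (u v : signed_point n) : (u == v) = (u.1 == v.1) && (u.2 == v.2) by [].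
case: x => x b; rewrite permM !permE /= !pE /=.
case: (eqVneq x i) => [->|xi] /=; rewrite ?pE /= ?eqxx ?neq_ji ?(negPf neq_ij) /=.
  by case: b; case: c => //=; rewrite ?pE /= ?eqxx ?neq_ji ?(negPf neq_ij).
case: (eqVneq x j) => [->|xj] /=; rewrite ?pE /= ?eqxx ?neq_ji ?(negPf neq_ij) /=.
  by case: b; case: c => //=; rewrite ?pE /= ?eqxx ?neq_ji ?(negPf neq_ij).
by rewrite (negPf xi) (negPf xj).
Qed.

Lemma root_reflectionK (n : nat) (i j : 'I_n) (c : bool) :
  i != j -> root_reflection i j c * root_reflection i j c = 1.
Proof.
move=> ij; apply/permP=> -[x b]; rewrite permM perm1 !root_reflectionE //=.
case: (eqVneq x i) => [->|xi] /=.
  by rewrite eqxx eq_sym (negPf ij) addbK.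
by case: (eqVneq x j) => [->|xj] /=; rewrite ?eqxx ?addbK // (negPf xi) (negPf xj).
Qed.

Lemma order_root_reflectionM (n : nat) (i j l : 'I_n) (c d : bool) :
  i != j -> j != l -> i != l ->
  #[root_reflection i j c * root_reflection j l d] = 3.
Proof.
move=> ij jl il; set g := _ * _.
have [ji lj li] : [/\ j == i = false, l == j = false & l == i = false].
  by split; rewrite eq_sym; apply: negbTE.
have gE x b : g (x, b) = if x == i then (l, b (+) c (+) d)
    else if x == j then (i, b (+) c) else if x == l then (j, b (+) d) else (x, b).
  rewrite permM !root_reflectionE //=.
  case: (eqVneq x i) => [_|xi] /=; first by rewrite eqxx.
  case: (eqVneq x j) => [_|xj] /=; first by rewrite (negPf ij) (negPf il).
  by rewrite (negPf xj).
clearbody g; apply: nt_prime_order => //.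
  apply/permP=> -[x b]; rewrite !expgS expg0 mulg1 perm1 !permM gE.
  case: (eqVneq x i) => [->|xi].
    by rewrite gE li lj eqxx gE ji eqxx; congr pair; case: b c d {gE} => [] [] [].
  case: (eqVneq x j) => [->|xj].
    by rewrite gE eqxx gE li lj eqxx; congr pair; case: b c d {gE} => [] [] [].
  case: (eqVneq x l) => [->|xl].
    by rewrite gE ji eqxx gE eqxx; congr pair; case: b c d {gE} => [] [] [].
  by rewrite !gE (negPf xi) (negPf xj) (negPf xl) gE (negPf xi) (negPf xj) (negPf xl).
apply/eqP => g1; have := gE i false; rewrite g1 perm1 eqxx => -[/eqP].
by rewrite (negPf il).
Qed.

Lemma root_reflection_disjoint (n : nat) (i j k l : 'I_n) (c d : bool) :
  i != j -> k != l -> i != k -> i != l -> j != k -> j != l ->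
  commute (root_reflection i j c) (root_reflection k l d).
Proof.
move=> ij kl ik il jk jl; apply/permP=> -[x b]; rewrite permM [RHS]permM.
have [ki li kj lj] : [/\ k == i = false, l == i = false, k == j = false & l == j = false].
  by split; rewrite eq_sym; apply: negbTE.
rewrite !root_reflectionE //=.
case: (eqVneq x i) => [->|xi] /=.
  by rewrite (negPf jk) (negPf jl) (negPf ik) (negPf il) /= eqxx.
case: (eqVneq x j) => [->|xj] /=.
  by rewrite (negPf jk) (negPf jl) (negPf ik) (negPf il) /= eqxx eq_sym (negPf ij).
case: (eqVneq x k) => [_|xk] /=; first by rewrite li lj.
case: (eqVneq x l) => [_|xl] /=; first by rewrite ki kj.
by rewrite (negPf xi) (negPf xj).
Qed.

Lemma root_reflection_opposite (n : nat) (i j : 'I_n) (c d : bool) :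
  i != j -> commute (root_reflection i j c) (root_reflection i j d).
Proof.
move=> ij; apply/permP=> -[x b]; rewrite permM [RHS]permM !root_reflectionE //=.
case: (eqVneq x i) => [_|xi] /=.
  by rewrite eqxx [j == i]eq_sym (negPf ij) addbAC.
case: (eqVneq x j) => [_|xj] /=; first by rewrite eqxx addbAC.
by rewrite (negPf xi) (negPf xj).
Qed.

Lemma simple_reflection_lt (n k : nat) (i j : 'I_n) :
  i.+1 = k -> j = k :> nat -> simple_reflection n k = root_reflection i j false.
Proof.
move=> ik jk; rewrite /simple_reflection -ik /=; case: insubP => [i' _ /val_inj->|].
  rewrite ik -jk ltn_ord; congr (root_reflection _ _ _); apply: val_inj => /=.
  by rewrite ik -jk modn_small.
by rewrite ltn_ord.
Qed.

Lemma simple_reflection_last (n : nat) (i j : 'I_n) :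
  i.+2 = n -> j.+1 = n -> simple_reflection n n = root_reflection i j true.
Proof.
move=> hi hj; rewrite /simple_reflection ltnn; case: insubP => [j' _ j'E|].
  have -> : j' = j by apply: val_inj; rewrite /= j'E -{1}hj.
  congr (root_reflection _ _ _); apply: val_inj => /=.
  have -> : (j + n).-1 = i + n by lia.
  by rewrite modnDr modn_small.
by rewrite -{1}hj /= ltn_ord.
Qed.

Lemma order_simple_reflection (n k : nat) :
  3 < n -> 0 < k <= n -> #[simple_reflection n k] = 2.
Proof.
move=> n4 /andP[k0 kn].
suff [i [j [c [ij ->]]]] : exists i j c,
    i != j :> 'I_n /\ simple_reflection n k = root_reflection i j c.
  apply: nt_prime_order => //; first by rewrite expgS expg1 root_reflectionK.
  apply/eqP => /permP/(_ (i, false)); rewrite perm1 root_reflectionE //= eqxx.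
  by move=> -[/eqP]; rewrite eq_sym (negPf ij).
have [k_lt|k_eq] : k < n \/ k = n by lia.
  have i_lt : k.-1 < n by lia.
  exists (Ordinal i_lt), (Ordinal k_lt), false; split; last first.
    by apply: simple_reflection_lt => /=; lia.
  by rewrite -val_eqE /=; lia.
have [i_lt j_lt] : n.-2 < n /\ n.-1 < n by lia.
exists (Ordinal i_lt), (Ordinal j_lt), true; split.
  by rewrite -val_eqE /=; lia.
by rewrite k_eq; apply: simple_reflection_last => /=; lia.
Qed.

Lemma simple_reflection_braid (n k : nat) :
  3 < n -> 0 < k -> k.+1 < n ->
  #[simple_reflection n k * simple_reflection n k.+1] = 3.
Proof.
move=> n4 k0 kn.
have [i_lt j_lt l_lt] : [/\ k.-1 < n, k < n & k.+1 < n] by split; lia.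
rewrite (@simple_reflection_lt n k (Ordinal i_lt) (Ordinal j_lt)) /=; [|lia..].
rewrite (@simple_reflection_lt n k.+1 (Ordinal j_lt) (Ordinal l_lt)) //=.
by apply: order_root_reflectionM; rewrite -val_eqE /=; lia.
Qed.

Lemma simple_reflection_braid_last (n : nat) :
  3 < n -> #[simple_reflection n n.-2 * simple_reflection n n] = 3.
Proof.
move=> n4.
have [i_lt j_lt l_lt] : [/\ n.-2.-1 < n, n.-2 < n & n.-1 < n] by split; lia.
rewrite (@simple_reflection_lt n _ (Ordinal i_lt) (Ordinal j_lt)) /=; [|lia..].
rewrite (@simple_reflection_last n (Ordinal j_lt) (Ordinal l_lt)) /=; [|lia..].
by apply: order_root_reflectionM; rewrite -val_eqE /=; lia.
Qed.

Lemma simple_reflection_comm (n j k : nat) :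
  3 < n -> 0 < j -> j < k <= n ->
  ~~ ((k == j.+1) && (k < n)) -> ~~ ((j == n.-2) && (k == n)) ->
  commute (simple_reflection n j) (simple_reflection n k).
Proof.
move=> n4 j0 /andP[jk kn] h1 h2.
have [i_lt j_lt] : j.-1 < n /\ j < n by lia.
rewrite (@simple_reflection_lt n _ (Ordinal i_lt) (Ordinal j_lt)) /=; [|lia..].
have [k_lt|k_eq] : k < n \/ k = n by lia.
  have l_lt : k.-1 < n by lia.
  rewrite (@simple_reflection_lt n _ (Ordinal l_lt) (Ordinal k_lt)) /=; [|lia..].
  by apply: root_reflection_disjoint; rewrite -val_eqE /=; lia.
have [p_lt q_lt] : n.-2 < n /\ n.-1 < n by lia.
rewrite k_eq (@simple_reflection_last n (Ordinal p_lt) (Ordinal q_lt)) /=; [|lia..].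
have [j_eq|j_neq] := eqVneq j n.-1.
  have -> : Ordinal i_lt = Ordinal p_lt by apply: val_inj => /=; lia.
  have -> : Ordinal j_lt = Ordinal q_lt by apply: val_inj => /=; lia.
  by apply: root_reflection_opposite; rewrite -val_eqE /=; lia.
by apply: root_reflection_disjoint; rewrite -val_eqE /=; lia.
Qed.

(* Every set of boxes has a linear extension. *)

Definition box_height (n : nat) (x : box n) : nat :=
  match x with
  | Lower i => i | MidA => n.-2 | MidB => n.-2 | Upper i => n.-2.*2 - i
  end.

Lemma ltQ_height (n : nat) (x y : box n) :
  ltQ x y -> box_height x < box_height y.
Proof.
have step (u v : box n) : coverQ u v -> box_height u < box_height v.
  by case: u v => [i|||i] [j|||j] //=; try have := ltn_ord i; try have := ltn_ord j; lia.
have le (u v : box n) : leQ u v -> box_height u <= box_height v.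
  case/connectP=> p + ->; elim: p u => [//|w p IHp] u /andP[uw /IHp].
  by apply: leq_trans; apply: ltnW; apply: step.
case/andP=> neq_xy /connectP[[|z p] /=]; first by move=> _ eq_yx; rewrite eq_yx eqxx in neq_xy.
case/andP=> xz pz def_y; apply: leq_trans (step _ _ xz) _; apply: le.
by apply/connectP; exists p.
Qed.

Lemma linear_extension_exists (n : nat) (O : {set box n}) :
  exists e : seq (boxes_of O), linear_extension e.
Proof.
pose r (x y : boxes_of O) := box_height (val x) <= box_height (val y).
have r_total : total r by move=> x y; apply: leq_total.
have r_trans : transitive r by move=> y x z; apply: leq_trans.
exists (sort r (enum {: boxes_of O})); split.
- by rewrite sort_uniq enum_uniq.
- by move=> x; rewrite mem_sort mem_enum.
move=> x y /ltQ_height lt_xy; rewrite ltnNge; apply/negP => le_yx.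
have in_e z : z \in sort r (enum {: boxes_of O}) by rewrite mem_sort mem_enum.
have := sorted_leq_index r_trans (fun z => leqnn _) (sort_sorted r_total _).
by move/(_ _ y x (in_e y) (in_e x) le_yx); rewrite /r leqNgt lt_xy.
Qed.

(* A box above both middle boxes is above the conjugates of the boxes it
   covers, so these conjugates belong to any order ideal containing it. *)

Lemma box_conj_leQ (n : nat) (b c : box n) :
  ltQ MidA c -> ltQ MidB c -> coverQ b c -> leQ (box_conj b) c.
Proof.
move=> hA hB; have [_ leA] := andP hA; have [_ leB] := andP hB.
have lowA (i : 'I_n.-2) : leQ (Lower i) MidA.
  have [m] := ubnP (n.-2 - i); elim: m i => // m IHm i; rewrite ltnS => le_m.
  have lti := ltn_ord i; have [|i_lt] := eqVneq i.+1 n.-2.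
    by move=> eq_i; apply: connect1; rewrite /= eq_i.
  have i1 : i.+1 < n.-2 by lia.
  apply: (@connect_trans _ _ (Lower (Ordinal i1))); first by apply: connect1 => /=.
  by apply: IHm => /=; lia.
case: c hA hB leA leB => [j|||j] /ltQ_height /= + /ltQ_height /= + leA leB.
- by have := ltn_ord j; lia.
- by rewrite ltnn.
- by rewrite ltnn.
case: b => [i|||i] //= _ _ _; apply: connect_trans leA; exact: lowA.
Qed.

(* Main.v *)
Require Import Defs.
From mathcomp Require Import all_boot all_fingroup zify.

(* Write a root as a difference x - y of two signed unit vectors.  By the exchange
   property, v < v s_k exactly when v sends the simple root of s_k to a positive
   root.  Boxes outside of O may be read as boxes of Q with entry +, so every
   diagram is read along s_1, ..., s_(n-2), {s_(n-1), s_n}, s_(n-2), ..., s_1.  Its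
   first half uses distinct simple reflections and never fails.  In the second half
   let M_k be the product of the factors from b'_k down to b_k.  Since M_(k+1)
   fixes e_1, ..., e_k, the condition fails at b_k exactly when D(b'_k) = 0 and
   M_(k+1) fixes e_(k+1).  If both boxes labelled k+1 (both middle boxes, when
   k = n-2) have entry +, then M_(k+1) does fix e_(k+1); otherwise, peeling off
   these two factors, M_(k+1) can only fix e_(k+1) if D(b'_(k+1)) = 0 and M_(k+2)
   fixes e_(k+2), which is the same failure one step further in. *)

Set Implicit Arguments.
Unset Strict Implicit.
Unset Printing Implicit Defensive.

Local Open Scope nat_scope.
Local Open Scope group_scope.

(** * Signed unit vectors, positive roots and their reflections *)

Definition negp (n : nat) (x : signed_point n) : signed_point n := (x.1, ~~ x.2).

Lemma negpK (n : nat) : involutive (@negp n).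
Proof. by case=> i b; rewrite /negp /= negbK. Qed.

(* The vectors -e_i, e_i in the order e_1 > ... > e_n > -e_n > ... > -e_1, in
   which x - y is a positive root exactly when x comes before y. *)
Definition rank (n : nat) (x : signed_point n) : nat :=
  if x.2 then n.*2 - x.1.+1 else x.1.

Lemma rank_inj (n : nat) : injective (@rank n).
Proof.
move=> [i [|]] [j [|]] /= H; have := ltn_ord i; have := ltn_ord j;
  rewrite /rank /= in H => hj hi.
- by congr pair; apply: val_inj => /=; lia.
- by lia.
- by lia.
- by congr pair; apply: val_inj => /=; lia.
Qed.

(** When [x.1 != y.1] this is the reflection in the root x - y, acting on signed unit vectors. *)
Definition reflection (n : nat) (x y : signed_point n) : {perm signed_point n} :=
  tperm x y * tperm (negp x) (negp y).

Lemma root_reflectionP (n : nat) (i j : 'I_n) (c : bool) :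
  root_reflection i j c = reflection (i, false) (j, c).
Proof. by []. Qed.

(** The differences x - y and (-y) - (-x) are the same root. In terms of permutations, the two
    transpositions are disjoint and hence commute. *)
Lemma reflectionN (n : nat) (x y : signed_point n) :
  x.1 != y.1 -> reflection (negp y) (negp x) = reflection x y.
Proof.
move=> xy; rewrite /reflection !negpK [tperm y x]tpermC [tperm (negp y) _]tpermC.
set s := tperm x y; apply/commgP/conjg_fixP; rewrite tpermJ.
have H (u v : signed_point n) : u.1 != v.1 -> u != v by apply: contra => /eqP->.
have H2 (u : signed_point n) : u != negp u.
  by case: u => a []; rewrite /negp xpair_eqE /= andbF.
by rewrite !tpermD // ?H2 // H //= eq_sym.
Qed.

Lemma reflectionK (n : nat) (x y : signed_point n) :
  x.1 != y.1 -> reflection x y * reflection x y = 1.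
Proof.
move=> xy; rewrite {1 2}/reflection.
have := reflectionN xy; rewrite /reflection !negpK [tperm y x]tpermC [tperm (negp y) _]tpermC.
by move=> E; rewrite -{1}E -mulgA [X in _ * X]mulgA tperm2 mul1g tperm2.
Qed.

Lemma reflectionJ (n : nat) (x y : signed_point n) (g : {perm signed_point n}) :
  (forall u, g (negp u) = negp (g u)) -> reflection x y ^ g = reflection (g x) (g y).
Proof. by move=> gN; rewrite /reflection conjMg !tpermJ !gN. Qed.

Lemma negp_root_reflection (n : nat) (i j : 'I_n) (c : bool) (x : signed_point n) :
  i != j -> root_reflection i j c (negp x) = negp (root_reflection i j c x).
Proof.
move=> ij; rewrite !root_reflectionE //= /negp.
by case: ifP => _ /=; [|case: ifP => _ //=]; rewrite addNb.
Qed.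

(** Puts s_n and the other simple reflections in one form, so that later arguments treat them
    together. *)
Lemma simple_reflection_root (n k : nat) : 3 < n -> 0 < k <= n ->
  exists i j : 'I_n, exists c : bool,
    [/\ simple_reflection n k = root_reflection i j c, j = i.+1 :> nat
      & c -> j.+1 = n].
Proof.
move=> n4 /andP[k0 kn]; have [k_lt|k_eq] : k < n \/ k = n by lia.
  have i_lt : k.-1 < n by lia.
  exists (Ordinal i_lt), (Ordinal k_lt), false; split=> //=; last lia.
  by apply: simple_reflection_lt => /=; lia.
have [i_lt j_lt] : n.-2 < n /\ n.-1 < n by lia.
exists (Ordinal i_lt), (Ordinal j_lt), true; split=> /=; [|lia..].
by rewrite k_eq; apply: simple_reflection_last => /=; lia.
Qed.

Lemma mem_simple_reflections (n k : nat) :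
  0 < k <= n -> simple_reflection n k \in simple_reflections n.
Proof.
case: k => // k kn; apply/imsetP; exists (Ordinal (kn : k < n)) => //.
Qed.

Lemma simple_reflectionsP (n : nat) (s : {perm signed_point n}) : 3 < n ->
  s \in simple_reflections n -> exists i j : 'I_n, exists c : bool,
    [/\ s = root_reflection i j c, j = i.+1 :> nat & c -> j.+1 = n].
Proof.
by move=> n4 /imsetP[k _ ->]; apply: simple_reflection_root => //=; apply: ltn_ord.
Qed.

(* That is, a simple reflection permutes the positive roots other than its own. *)
Lemma simple_reflection_crossing (n : nat) (i j : 'I_n) (c : bool)
    (x y : signed_point n) :
  j = i.+1 :> nat -> (c -> j.+1 = n) -> x.1 != y.1 -> rank x < rank y ->
  rank (root_reflection i j c y) < rank (root_reflection i j c x) ->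
  reflection x y = root_reflection i j c.
Proof.
move=> ji jn xy; have ij : i != j by rewrite -val_eqE /=; lia.
rewrite root_reflectionP !root_reflectionE //.
(* The two alternatives are the two ways to write the simple root as a difference of signed unit
   vectors; [reflectionN] identifies their reflections. *)
suff: rank x < rank y -> rank (if y.1 == i then (j, y.2 (+) c)
     else if y.1 == j then (i, y.2 (+) c) else y) <
   rank (if x.1 == i then (j, x.2 (+) c)
     else if x.1 == j then (i, x.2 (+) c) else x) ->
     (x = (i, false) /\ y = (j, c)) \/ (x = (j, ~~ c) /\ y = (i, true)).
  move=> H h1 h2; have [[-> ->]//|[-> ->]] := H h1 h2.
  by rewrite -[RHS]reflectionN.
case: x y xy => [x bx] [y by_] /=; rewrite /rank /=.
have pE (u v : 'I_n) a b : u = v :> nat -> a = b -> (u, a) = (v, b).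
  by move=> /val_inj-> ->.
have := ltn_ord x; have := ltn_ord y; have := ltn_ord i; have := ltn_ord j.
rewrite -!(inj_eq val_inj) /=.
case: (eqVneq (x : nat) i) => xi; case: (eqVneq (y : nat) i) => yi;
case: (eqVneq (x : nat) j) => xj; case: (eqVneq (y : nat) j) => yj /=;
case: c jn => jn; case: bx; case: by_ => //= *; try lia;
solve [left; split; apply: pE => //; lia | right; split; apply: pE => //; lia].
Qed.

(** * The exchange property and Bruhat comparison of v with v s *)

Lemma negp_gen (n : nat) (v : {perm signed_point n}) (x : signed_point n) : 3 < n ->
  v \in <<simple_reflections n>> -> v (negp x) = negp (v x).
Proof.
move=> n4 /word_length_mem/expg_wordP[c [_ cS ->]].
elim: c cS x => [|s c IHc] /=; first by move=> _ x; rewrite big_nil !perm1.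
move=> /andP[/(simple_reflectionsP n4)[i [j [d [Es ji _]]]] /IHc{}IHc] x.
have ij : i != j by rewrite -val_eqE /=; lia.
by rewrite big_cons !permM Es negp_root_reflection.
Qed.

Lemma mem_gen_word (gT : finGroupType) (S : {set gT}) (c : seq gT) :
  all [in S] c -> \prod_(x <- c) x \in <<S>>.
Proof. by move=> /allP cS; rewrite big_seq group_prod // => x /cS; apply: mem_gen. Qed.

(* Products of permutations compose from left to right, so the action of W on
   vectors for which v(w x) = (v w) x sends x to v^-1 x.  Reading the word from the
   right, some letter s first turns the root negative; the letters after s then map
   the root to the simple root of s, so multiplying by its reflection deletes s. *)
Lemma exchange_word (n : nat) (c : seq {perm signed_point n}) (x y : signed_point n) :
  3 < n -> all [in simple_reflections n] c -> x.1 != y.1 -> rank x < rank y ->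
  let v := \prod_(s <- c) s in
  rank (v^-1 y) < rank (v^-1 x) ->
  v * reflection x y \in simple_reflections n ^+ (size c).-1 /\ 0 < size c.
Proof.
move=> n4 + xy rxy; elim: c => [|s c IHc] /=.
  by rewrite big_nil invg1 !perm1 => _; lia.
case/andP=> sS cS; rewrite big_cons; set w := \prod_(j <- c) j in IHc *.
rewrite invMg !permM => H; split=> //.
have wS : w \in <<simple_reflections n>> by apply: mem_gen_word.
have wN u : w^-1 (negp u) = negp (w^-1 u) by rewrite negp_gen ?groupV.
have nw : (w^-1 x).1 != (w^-1 y).1.
  apply/eqP => E.
  have : w^-1 x = w^-1 y \/ w^-1 x = negp (w^-1 y).
    case: (w^-1 x) (w^-1 y) E => a b [a' b'] /= ->.
    by rewrite /negp; case: b b' => [] []; auto.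
  rewrite -wN; case=> /perm_inj E2; move: xy; by rewrite E2 eqxx.
have [neg|pos] := ltnP (rank (w^-1 y)) (rank (w^-1 x)).
  have [h h0] := IHc cS neg; rewrite -mulgA.
  by rewrite -(prednK h0) expgS mem_mulg.
have {}pos : rank (w^-1 x) < rank (w^-1 y).
  by rewrite ltn_neqAle pos andbT; apply: contra nw => /eqP/rank_inj->.
have [i [j [d [Es ji jn]]]] := simple_reflectionsP n4 sS.
have ij : i != j by rewrite -val_eqE /=; lia.
have sV : s^-1 = s by apply/eqP; rewrite eq_invg_mul Es root_reflectionK.
rewrite sV in H; rewrite Es in H.
have /esym := simple_reflection_crossing ji jn nw pos H; rewrite -Es => Es2.
have -> : s * w * reflection x y = w.
  have E : reflection x y ^ w^-1 = s by rewrite reflectionJ // Es2.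
  have : s * w = w * reflection x y by rewrite -E conjgE invgK !mulgA mulgKV.
  by move=> E2; rewrite E2 -mulgA reflectionK ?mulg1.
by apply/expg_wordP; exists c.
Qed.

Lemma bruhat_lt_length (gT : finGroupType) (S : {set gT}) (u v : gT) :
  bruhat_lt S u v -> word_length S u < word_length S v.
Proof.
case/andP => uv /connectP[p]; elim: p u uv => [|w p IHp] u uv /=.
  by move=> _ E; rewrite E eqxx in uv.
case/andP => /existsP[t /andP[_ /and3P[_ _ uw]]] pw E.
have [Ewv|wv] := eqVneq w v; first by rewrite -Ewv.
exact: ltn_trans uw (IHp _ wv pw E).
Qed.

(** Apply the exchange property to a reduced word of [v]: a product of one letter fewer remains. *)
Lemma word_length_descent (n : nat) (v : {perm signed_point n}) (x y : signed_point n) :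
  3 < n -> v \in <<simple_reflections n>> -> x.1 != y.1 -> rank x < rank y ->
  rank (v^-1 y) < rank (v^-1 x) ->
  word_length (simple_reflections n) (v * reflection x y) <
    word_length (simple_reflections n) v.
Proof.
move=> n4 /word_length_mem/expg_wordP[c [<- cS ->]] xy rxy H.
have [/word_length_min h c0] := exchange_word n4 cS xy rxy H.
by apply: leq_ltn_trans h _; rewrite prednK.
Qed.

(** If v sent the simple root of s to a negative root, v s would be shorter than v, against the
    Bruhat inequality. If v sends it to a positive root, v s sends it to a negative one, so v = (v
    s) s is shorter than v s, and s itself gives a single Bruhat step. *)
Lemma bruhat_lt_simple (n k : nat) (v : {perm signed_point n}) (i j : 'I_n) (c : bool) :
  3 < n -> 0 < k <= n -> simple_reflection n k = root_reflection i j c -> i < j ->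
  v \in <<simple_reflections n>> ->
  bruhat_lt (simple_reflections n) v (v * simple_reflection n k) =
    (rank (v^-1 (i, false)) < rank (v^-1 (j, c))).
Proof.
move=> n4 k1 E ij vS; have sS := mem_simple_reflections k1.
have nij : i != j by rewrite -val_eqE neq_ltn ij.
have rij : rank (i, false) < rank (j, c).
  by rewrite /rank /=; have := ltn_ord i; have := ltn_ord j; case: (c); lia.
set s := simple_reflection n k in E sS *.
have ss : s * s = 1 by rewrite E root_reflectionK.
have sV : s^-1 = s by apply/eqP; rewrite eq_invg_mul ss.
apply/idP/idP => [/bruhat_lt_length lt_vs|H].
  rewrite ltnNge leq_eqVlt negb_or; apply/andP; split.
    by rewrite (inj_eq (@rank_inj n)) (inj_eq perm_inj) xpair_eqE eq_sym (negPf nij).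
  apply/negP => /(@word_length_descent _ _ (i, false) (j, c) n4 vS nij rij).
  by rewrite -root_reflectionP -E ltnNge ltnW.
have lt_vs : word_length (simple_reflections n) v <
             word_length (simple_reflections n) (v * s).
  rewrite -{1}[v](mulgK s) {1}sV {2}E root_reflectionP.
  apply: word_length_descent => //; first by rewrite groupM // mem_gen.
  rewrite invMg sV !permM {1 2}E !root_reflectionE //= eqxx.
  by rewrite [j == i]eq_sym (negPf nij) addbb eqxx.
rewrite /bruhat_lt /bruhat_le; apply/andP; split.
  by apply/eqP => Ev; rewrite -Ev ltnn in lt_vs.
apply: connect1; apply/existsP; exists s; rewrite vS eqxx lt_vs !andbT.
exact: (subsetP (sub_class_support _ _)).
Qed.

(** * Action of a single factor on coordinates and signs *)

Definition coord (n : nat) (x : signed_point n) : nat := x.1.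

Lemma coord_lt (n : nat) (x : signed_point n) : coord x < n.
Proof. exact: ltn_ord. Qed.

Lemma rankE (n : nat) (x : signed_point n) :
  rank x = if x.2 then n.*2 - (coord x).+1 else coord x.
Proof. by []. Qed.

(** The contribution of a box labelled [k] to the partial products; [z] says that its entry is 0. *)
Definition factor (n k : nat) (z : bool) : {perm signed_point n} :=
  if z then simple_reflection n k else 1.

Lemma factor_gen (n k : nat) (z : bool) :
  0 < k <= n -> factor n k z \in <<simple_reflections n>>.
Proof.
by move=> k1; rewrite /factor; case: z => //; apply/mem_gen/mem_simple_reflections.
Qed.

Lemma factorV (n k : nat) (z : bool) : 3 < n -> 0 < k <= n ->
  (factor n k z)^-1 = factor n k z.
Proof.
move=> n4 /(simple_reflection_root n4)[i [j [c [E ji _]]]].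
rewrite /factor; case: z; rewrite ?invg1 //.
by apply/eqP; rewrite eq_invg_mul E root_reflectionK // -val_eqE /=; lia.
Qed.

(** A factor is an involution, but the inverse is kept so that the lemma matches the terms that
    [invMg] produces from the inverse of a word. *)
Lemma factorVE (n k : nat) (z : bool) (x : signed_point n) : 3 < n -> 0 < k < n ->
  coord ((factor n k z)^-1 x) = (if z then
      if coord x == k.-1 then k else if coord x == k then k.-1 else coord x
    else coord x) /\ ((factor n k z)^-1 x).2 = x.2.
Proof.
move=> n4 kn; rewrite factorV; [|lia..].
rewrite /factor; case: z; rewrite ?perm1 //.
have [i_lt j_lt] : k.-1 < n /\ k < n by lia.
rewrite (@simple_reflection_lt n k (Ordinal i_lt) (Ordinal j_lt)) /=; [|lia..].
rewrite root_reflectionE -?val_eqE /=; last lia.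
by case: ifP => _ /=; [|case: ifP => _ /=]; rewrite ?addbF.
Qed.

Lemma factor_lastVE (n : nat) (z : bool) (x : signed_point n) : 3 < n ->
  coord ((factor n n z)^-1 x) = (if z then
      if coord x == n.-2 then n.-1 else if coord x == n.-1 then n.-2 else coord x
    else coord x) /\ ((factor n n z)^-1 x).2 = x.2 (+) (z && (n.-2 <= coord x)).
Proof.
move=> n4; rewrite factorV; [|lia..].
rewrite /factor; case: z; rewrite ?perm1 ?addbF //=.
have [i_lt j_lt] : n.-2 < n /\ n.-1 < n by lia.
rewrite (@simple_reflection_last n (Ordinal i_lt) (Ordinal j_lt)) /=; [|lia..].
rewrite root_reflectionE -?val_eqE /=; last lia.
have := coord_lt x.
case: (eqVneq (coord x) n.-2) => [->|h1] /=; first by rewrite leqnn.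
case: (eqVneq (coord x) n.-1) => [->|h2] /= hx; first by have -> : n.-2 <= n.-1 by lia.
have -> : n.-2 <= coord x = false by lia.
by rewrite addbF.
Qed.

Lemma signed_point_eq (n : nat) (x y : signed_point n) :
  coord x = coord y -> x.2 = y.2 -> x = y.
Proof. by case: x y => [a b] [c d]; rewrite /coord /= => /val_inj-> ->. Qed.

(** * Words along the two arms of Q and the vectors they fix *)

(** With [f] marking zero entries, these are the factors of b'_(k+1), ..., b'_(k+m) in reading
    order. *)
Definition upper_word (n : nat) (f : nat -> bool) (k m : nat) : {perm signed_point n} :=
  \prod_(i <- iota k m) factor n i.+1 (f i).

(** The factors of b_(k+m), ..., b_(k+1): the lower arm is read with decreasing labels. *)
Definition lower_word (n : nat) (f : nat -> bool) (k m : nat) : {perm signed_point n} :=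
  \prod_(i <- rev (iota k m)) factor n i.+1 (f i).

(** For [k + m = n.-2] this is M_(k+1), indices being shifted by one; for [m = 0] only the two
    middle factors remain. *)
Definition nested_word (n : nat) (zU zL : nat -> bool) (zA zB : bool) (k m : nat) :
    {perm signed_point n} :=
  upper_word n zU k m * (factor n n.-1 zA * factor n n zB) * lower_word n zL k m.

Lemma nested_wordS (n : nat) (zU zL : nat -> bool) (zA zB : bool) (k m : nat) :
  nested_word n zU zL zA zB k m.+1 =
    factor n k.+1 (zU k) * nested_word n zU zL zA zB k.+1 m * factor n k.+1 (zL k).
Proof.
rewrite /nested_word /upper_word /lower_word /= rev_cons big_cons big_rcons /=.
by rewrite !mulgA.
Qed.

Lemma nested_wordSV (n : nat) (zU zL : nat -> bool) (zA zB : bool) (k m : nat)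
    (x : signed_point n) :
  (nested_word n zU zL zA zB k m.+1)^-1 x =
    (factor n k.+1 (zU k))^-1 ((nested_word n zU zL zA zB k.+1 m)^-1
      ((factor n k.+1 (zL k))^-1 x)).
Proof.
by rewrite nested_wordS; move: (nested_word _ _ _ _ _ _ _) => N; rewrite !invMg !permM.
Qed.

(** Only s_1, ..., s_k can occur, and they move only the zero-based coordinates 0, ..., k. *)
Lemma upper_word_fix (n : nat) (f : nat -> bool) (k : nat) (x : signed_point n) :
  3 < n -> k < n -> k < coord x -> (upper_word n f 0 k)^-1 x = x.
Proof.
move=> n4; elim: k => [|k IHk] kn kx; first by rewrite /upper_word big_nil invg1 perm1.
rewrite /upper_word -addn1 iotaD big_cat big_seq1 add0n invMg permM -/(upper_word n f 0 k).
have [E1 E2] := factorVE (f k) x n4 (kn : 0 < k.+1 < n).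
rewrite (_ : _ x = x) ?IHk //; [lia..|].
apply: signed_point_eq E2; rewrite E1; case: ifP => //= _.
by rewrite !ifF //; lia.
Qed.

(** The inverse applies the factor of s_k first. Each nontrivial factor lowers the coordinate by
    one; after the first trivial one, the remaining factors fix the point. No s_n occurs, so the
    sign stays. *)
Lemma upper_word_top (n : nat) (f : nat -> bool) (k : nat) (x : signed_point n) :
  3 < n -> k < n -> coord x = k ->
  coord ((upper_word n f 0 k)^-1 x) <= k /\ ((upper_word n f 0 k)^-1 x).2 = x.2.
Proof.
move=> n4; elim: k x => [|k IHk] x kn kx.
  by rewrite /upper_word big_nil invg1 perm1 kx.
rewrite /upper_word -addn1 iotaD big_cat big_seq1 add0n invMg permM -/(upper_word n f 0 k).
have [E1 E2] := factorVE (f k) x n4 (kn : 0 < k.+1 < n).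
move: E1; rewrite kx /= eqxx (gtn_eqF (ltnSn k)); case: (f k) E2 => E2 E1.
  have [h1 h2] := IHk _ (ltnW kn) E1; rewrite h2 E2; by rewrite addn1 leqW.
by rewrite upper_word_fix ?E1 ?E2 //; [lia|lia].
Qed.

(** The letters s_(k+1), ..., s_n do not touch the zero-based coordinates below [k]. *)
Lemma nested_word_fix (n : nat) (zU zL : nat -> bool) (zA zB : bool) (k m : nat)
    (x : signed_point n) :
  3 < n -> k + m = n.-2 -> coord x < k -> (nested_word n zU zL zA zB k m)^-1 x = x.
Proof.
move=> n4; elim: m k => [|m IHm] k km xk.
  rewrite /nested_word /upper_word /lower_word !big_nil mul1g mulg1 invMg permM.
  have [E1 E2] := factor_lastVE zB x n4.
  have E : (factor n n zB)^-1 x = x.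
    apply: signed_point_eq.
      by rewrite E1; case: (zB) => //; rewrite !ifF //; lia.
    by rewrite E2 (_ : n.-2 <= coord x = false) ?andbF ?addbF //; lia.
  rewrite E; have [|F1 F2] := @factorVE n n.-1 zA x n4; first lia.
  apply: signed_point_eq F2.
  by rewrite F1; case: (zA) => //; rewrite !ifF //; lia.
rewrite nested_wordSV.
have kn : 0 < k.+1 < n by lia.
have fix_factor z : (factor n k.+1 z)^-1 x = x.
  have [E1 E2] := factorVE z x n4 kn; apply: signed_point_eq E2.
  by rewrite E1; case: (z) => //=; rewrite !ifF //; lia.
by rewrite fix_factor IHm ?fix_factor //; lia.
Qed.

(** Points with coordinate below [k] are fixed, so by injectivity no other point can land there. *)
Lemma nested_word_stable (n : nat) (zU zL : nat -> bool) (zA zB : bool) (k m : nat)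
    (x : signed_point n) :
  3 < n -> k + m = n.-2 -> k <= coord x ->
  k <= coord ((nested_word n zU zL zA zB k m)^-1 x).
Proof.
move=> n4 km kx; rewrite leqNgt; apply/negP => H.
have /perm_inj E := nested_word_fix zU zL zA zB n4 km H.
by rewrite E ltnNge kx in H.
Qed.

(** Once the outermost pair of factors is trivial, the letters left inside do not reach coordinate
    [k]. *)
Lemma nested_word_plus (n : nat) (zU zL : nat -> bool) (zA zB : bool) (k m : nat)
    (x : signed_point n) :
  3 < n -> k + m = n.-2 -> coord x = k ->
  (0 < m -> ~~ zU k /\ ~~ zL k) -> (m = 0 -> ~~ zA /\ ~~ zB) ->
  (nested_word n zU zL zA zB k m)^-1 x = x.
Proof.
move=> n4; case: m => [|m] km xk Hm H0.
  have [//|/negPf-> /negPf->] := H0.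
  by rewrite /nested_word /upper_word /lower_word !big_nil !mulg1 invg1 perm1.
have [//|/negPf U /negPf L] := Hm; rewrite nested_wordS U L mulg1 mul1g.
by apply: nested_word_fix => //; lia.
Qed.

(** The two quantified premises are the condition of the theorem at the zero boxes b'_(j+1); the
    last one says that the outermost pair contains a zero. They allow an induction that goes one
    step inwards. *)
Lemma nested_word_move (n : nat) (zU zL : nat -> bool) (zA zB : bool) (k m : nat)
    (x : signed_point n) :
  3 < n -> k + m = n.-2 -> coord x = k ->
  (forall j, k <= j -> j.+1 < n.-2 -> zU j -> zU j.+1 || zL j.+1) ->
  (forall j, k <= j -> j.+1 = n.-2 -> zU j -> zA || zB) ->
  (if m == 0 then zA || zB else zU k || zL k) ->
  (nested_word n zU zL zA zB k m)^-1 x != x.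
Proof.
move=> n4; elim: m k x => [|m IHm] k x km xk Hs H0 /= Hk; apply/eqP.
  rewrite /nested_word /upper_word /lower_word !big_nil mul1g mulg1 invMg permM.
  have [E1 E2] := factor_lastVE zB x n4; set y := _ x in E1 E2 *.
  have [|F1 F2] := @factorVE n n.-1 zA y n4; first lia.
  have xn : coord x = n.-2 by lia.
  move=> E; rewrite E in F1 F2; move: F1 F2; rewrite E1 E2 xn eqxx leqnn andbT.
  (* A single middle factor moves [x] to coordinate [n.-1]; both together bring it back with the
     opposite sign. *)
  case: (zA) (zB) (x.2) Hk => [] [] [] //= _; rewrite ?eqxx //; lia.
rewrite nested_wordSV.
have kn : 0 < k.+1 < n by lia.
have [E1 E2] := factorVE (zL k) x n4 kn; set y := _ x in E1 E2 *.
set w := (nested_word _ _ _ _ _ _ _)^-1 y => E.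
have [F1 F2] := factorVE (zU k) w n4 kn; rewrite E in F1 F2.
(* If b_(k+1) has entry +, the inner word fixes [x], and the factor of b'_(k+1), then nontrivial,
   moves it. *)
case: (zL k) E1 Hk => /= E1; last first.
  rewrite orbF => Uk; rewrite Uk in F1.
  have Ey : y = x by exact: signed_point_eq.
  have Ew : w = x by rewrite /w Ey nested_word_fix //; lia.
  by move: F1; rewrite Ew xk eqxx /=; lia.
move=> _; have yk : coord y = k.+1 by rewrite E1 xk eqxx.
have wk : k.+1 <= coord w by apply: nested_word_stable; rewrite ?yk //; lia.
(* The inner word keeps the point at or beyond [k.+1], so only a nontrivial factor of b'_(k+1) can
   bring it back to [k]. *)
case Uk : (zU k) F1 => F1; last by move: wk; rewrite -F1 xk ltnn.
(* The zero at b'_(k+1) supplies, through [Hs] or [H0], the last premise of [IHm]; yet a return to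
   [x] would force [w = y]. *)
have wy : w != y.
  apply: (IHm k.+1) => //; [lia| | |].
  - by move=> j kj; apply: Hs; lia.
  - by move=> j kj; apply: H0; lia.
  by case: eqP => m0; [apply: (H0 k)|apply: (Hs k)]; rewrite ?Uk //; lia.
case/eqP: wy; apply: signed_point_eq; last by rewrite -F2 E2.
by move: F1; rewrite yk xk /=; case: eqP; [|case: eqP]; lia.
Qed.

(** * The positivity test at each kind of box *)

(** Here [v] is the product read before b_(k+1), and x - y is the simple root of s_(k+1). The inner
    word fixes [x]. If the factor of b'_(k+1) is trivial, [x] ends at or below coordinate [k] with
    positive sign and stays ahead; otherwise [x] ends at e_(k+2). *)
Lemma lower_positive (n : nat) (zU zL : nat -> bool) (zA zB : bool) (k m : nat)
    (x y : signed_point n) :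
  3 < n -> k.+1 + m = n.-2 -> coord x = k -> coord y = k.+1 ->
  x.2 = false -> y.2 = false ->
  let v := upper_word n zU 0 k.+1 * nested_word n zU zL zA zB k.+1 m in
  (rank (v^-1 x) < rank (v^-1 y)) =
    ~~ (zU k && ((nested_word n zU zL zA zB k.+1 m)^-1 y == y)).
Proof.
move=> n4 km xk yk x2 y2 v.
have vE u : v^-1 u = (upper_word n zU 0 k)^-1 ((factor n k.+1 (zU k))^-1
    ((nested_word n zU zL zA zB k.+1 m)^-1 u)).
  rewrite /v /upper_word -(addn1 k) iotaD big_cat big_seq1 add0n addn1.
  by move: (nested_word _ _ _ _ _ _ _) => N; rewrite !invMg !permM.
have kn : 0 < k.+1 < n by lia.
rewrite !vE (nested_word_fix _ _ _ _ n4 km) ?xk //.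
set w := (nested_word _ _ _ _ _ _ _)^-1 y.
have wk : k.+1 <= coord w by apply: nested_word_stable; rewrite ?yk //; lia.
have wn := coord_lt w.
have [E1 E2] := factorVE (zU k) x n4 kn; set x' := _ x in E1 E2 *.
have [F1 F2] := factorVE (zU k) w n4 kn; set w' := _ w in F1 F2 *.
clearbody x' w' w.
have k_lt : k < n by lia.
case: (zU k) E1 F1 => /= E1 F1; last first.
  rewrite xk in E1; have [h1 h2] := upper_word_top zU n4 k_lt E1.
  rewrite (@upper_word_fix _ _ _ w') //; last lia.
  by rewrite !rankE h2 E2 x2; case: ifP => _; lia.
rewrite xk eqxx in E1; rewrite (@upper_word_fix _ _ _ x') //; last lia.
have -> : rank x' = k.+1 by rewrite !rankE E2 x2.
(* To overtake e_(k+2), the image [w] of [y] must be swapped down to coordinate [k] and be positive,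
   which means [w = y]. *)
have [wk1|wk1] := eqVneq (coord w) k.+1; last first.
  rewrite (_ : w == y = false); last by apply/eqP => Ew; rewrite Ew yk eqxx in wk1.
  have {}F1 : coord w' = coord w by rewrite F1 (negPf wk1) ifF //; lia.
  rewrite upper_word_fix //; last lia.
  by rewrite !rankE F1; case: ifP => _; lia.
have {}F1 : coord w' = k by rewrite F1 wk1 eqxx ifF //; lia.
have [h1 h2] := upper_word_top zU n4 k_lt F1.
rewrite !rankE h2 F2; have [w2|w2] := boolP w.2.
  rewrite (_ : w == y = false); last by apply/eqP => Ew; rewrite Ew y2 in w2.
  by lia.
rewrite (_ : w == y); first by lia.
by apply/eqP; apply: signed_point_eq; rewrite ?wk1 ?y2 //; apply/negbTE.
Qed.

(** The vector [x] stays positive and never moves to a later coordinate, while [y], of either sign,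
    lies beyond the reach of the word. *)
Lemma upper_positive (n : nat) (f : nat -> bool) (k : nat) (x y : signed_point n) :
  3 < n -> coord x = k -> coord y = k.+1 -> x.2 = false ->
  rank ((upper_word n f 0 k)^-1 x) < rank ((upper_word n f 0 k)^-1 y).
Proof.
move=> n4 xk yk x2; have := coord_lt y; rewrite yk => kn.
have k_lt : k < n by lia.
have [h1 h2] := upper_word_top f n4 k_lt xk.
rewrite (@upper_word_fix _ _ _ y) ?yk // !rankE h2 x2 yk.
by case: ifP => _; lia.
Qed.

(** The simple root of s_n is e_(n-1) - (-e_n). Neither s_(n-1) nor the upper word changes signs,
    and every positive vector precedes every negative one. *)
Lemma middleB_positive (n : nat) (f : nat -> bool) (z : bool) (x y : signed_point n) :
  3 < n -> coord x = n.-2 -> coord y = n.-1 -> x.2 = false -> y.2 = true ->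
  rank ((upper_word n f 0 n.-2 * factor n n.-1 z)^-1 x) <
  rank ((upper_word n f 0 n.-2 * factor n n.-1 z)^-1 y).
Proof.
move=> n4 xn yn x2 y2; rewrite invMg !permM.
have [|E1 E2] := @factorVE n n.-1 z x n4; first lia.
have [|F1 F2] := @factorVE n n.-1 z y n4; first lia.
case: z E1 E2 F1 F2 => E1 E2 F1 F2; last first.
  by rewrite !invg1 !perm1; apply: upper_positive => //; lia.
set x' := _ x in E1 E2 *; set y' := _ y in F1 F2 *; clearbody x' y'.
have {}E1 : coord x' = n.-1 by rewrite E1 ifT //; lia.
have {}F1 : coord y' = n.-2 by rewrite F1 ifF ?ifT //; lia.
have n_lt : n.-2 < n by lia.
have [h1 h2] := upper_word_top f n4 n_lt F1.
rewrite (@upper_word_fix _ _ _ x') ?E1 //; last lia.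
rewrite !rankE h2 E2 F2 x2 y2 E1; move: h1; move: (coord _) => c; lia.
Qed.

(** A nontrivial factor s_n makes both vectors negative and sends [x] to -e_n, the first of all
    negative vectors, where the upper word leaves it. *)
Lemma middleA_positive (n : nat) (f : nat -> bool) (z : bool) (x y : signed_point n) :
  3 < n -> coord x = n.-2 -> coord y = n.-1 -> x.2 = false -> y.2 = false ->
  rank ((upper_word n f 0 n.-2 * factor n n z)^-1 x) <
  rank ((upper_word n f 0 n.-2 * factor n n z)^-1 y).
Proof.
move=> n4 xn yn x2 y2; rewrite invMg !permM.
have [E1 E2] := factor_lastVE z x n4; have [F1 F2] := factor_lastVE z y n4.
case: z E1 E2 F1 F2 => E1 E2 F1 F2; last first.
  by rewrite !invg1 !perm1; apply: upper_positive => //; lia.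
set x' := _ x in E1 E2 *; set y' := _ y in F1 F2 *; clearbody x' y'.
have {}E1 : coord x' = n.-1 by rewrite E1 ifT //; lia.
have {}F1 : coord y' = n.-2 by rewrite F1 ifF ?ifT //; lia.
have n_lt : n.-2 < n by lia.
have [h1 h2] := upper_word_top f n4 n_lt F1.
rewrite (@upper_word_fix _ _ _ x') ?E1 //; last lia.
have n2_le : n.-2 <= n.-1 by lia.
rewrite !rankE h2 E2 F2 x2 y2 xn yn leqnn n2_le E1 /=.
move: h1; move: (coord _) => c; lia.
Qed.

(** * The order on Q and the two ways to read it *)

Lemma leQ_Lower (n : nat) (i j : 'I_n.-2) : i <= j -> leQ (Lower i) (Lower j).
Proof.
move: {2}(j - i)%N (erefl (j - i)%N) => m; elim: m j => [|m IHm] j jm ij.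
  have -> : i = j by apply: val_inj => /=; lia.
  exact: connect0.
have j1 : j.-1 < n.-2 by have := ltn_ord j; lia.
apply: connect_trans (IHm (Ordinal j1) _ _) _ => /=; [lia..|].
by apply: connect1 => /=; lia.
Qed.

Lemma leQ_Upper (n : nat) (i j : 'I_n.-2) : j <= i -> leQ (Upper i) (Upper j).
Proof.
move: {2}(i - j)%N (erefl (i - j)%N) => m; elim: m j => [|m IHm] j jm ij.
  have -> : i = j by apply: val_inj => /=; lia.
  exact: connect0.
have j1 : j.+1 < n.-2 by have := ltn_ord i; lia.
apply: connect_trans (IHm (Ordinal j1) _ _) _ => /=; [lia..|].
by apply: connect1 => /=; lia.
Qed.

Lemma leQ_Lower_Mid (n : nat) (i : 'I_n.-2) :
  leQ (Lower i) MidA /\ leQ (Lower i) MidB.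
Proof.
have j1 : n.-2.-1 < n.-2 by have := ltn_ord i; lia.
have h : leQ (Lower i) (Lower (Ordinal j1)).
  by apply: leQ_Lower => /=; have := ltn_ord i; lia.
by split; apply: connect_trans h _; apply: connect1 => /=; lia.
Qed.

Lemma leQ_Mid_Upper (n : nat) (i : 'I_n.-2) :
  leQ MidA (Upper i) /\ leQ MidB (Upper i).
Proof.
have j1 : n.-2.-1 < n.-2 by have := ltn_ord i; lia.
have h : leQ (Upper (Ordinal j1)) (Upper i).
  by apply: leQ_Upper => /=; have := ltn_ord i; lia.
by split; apply: connect_trans h; apply: connect1 => /=; lia.
Qed.

(** Positions in the two linear extensions of Q, which differ only on the incomparable middle boxes:
    [b] puts [MidB] below [MidA]. *)
Definition box_pos (n : nat) (b : bool) (x : box n) : nat :=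
  match x with
  | Lower i => i | MidA => n.-2 + b | MidB => n.-2 + ~~ b
  | Upper i => n.-2.*2.+1 - i
  end.

Lemma box_pos_inj (n : nat) (b : bool) : injective (@box_pos n b).
Proof.
move=> [i|||i] [j|||j] //=; try have := ltn_ord i; try have := ltn_ord j;
  case: b => /= *; try (exfalso; lia); by congr (_ _); apply: val_inj => /=; lia.
Qed.

(** Q is a chain apart from its two middle boxes. *)
Lemma box_pos_ltQ (n : nat) (b : bool) (x y : box n) : box_pos b x < box_pos b y ->
  ltQ x y \/ (if b then x = MidB /\ y = MidA else x = MidA /\ y = MidB).
Proof.
move=> H; rewrite /ltQ; case: eqVneq => [E|_] /=; first by rewrite E in H; lia.
have lUL i j : @leQ n (Lower i) (Upper j).
  by apply: connect_trans (leQ_Lower_Mid i).1 (leQ_Mid_Upper j).1.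
case: x y H => [i|||i] [j|||j] /=; try have := ltn_ord i; try have := ltn_ord j;
  case: b => *; try (exfalso; lia); try (by right); left;
  by [ apply: leQ_Lower; lia | apply: leQ_Upper; lia | apply: lUL
     | apply: (leQ_Lower_Mid _).1 | apply: (leQ_Lower_Mid _).2
     | apply: (leQ_Mid_Upper _).1 | apply: (leQ_Mid_Upper _).2].
Qed.

(** By decreasing [box_pos b], since linear extensions are read backwards. *)
Definition reading_order (n : nat) (b : bool) : seq (box n) :=
  map (@Upper n) (enum 'I_n.-2) ++ (if b then [:: MidA; MidB] else [:: MidB; MidA]) ++
  map (@Lower n) (rev (enum 'I_n.-2)).

Lemma mem_reading_order (n : nat) (b : bool) (x : box n) : x \in reading_order n b.
Proof.
rewrite /reading_order !mem_cat; case: x => [i|||i].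
- by rewrite (map_f (@Lower n)) ?orbT // mem_rev mem_enum.
- by case: b; rewrite !inE eqxx ?orbT.
- by case: b; rewrite !inE eqxx ?orbT.
by rewrite (map_f (@Upper n)) // mem_enum.
Qed.

Lemma box_pos_gt_trans (n : nat) (b : bool) :
  transitive (fun x y : box n => box_pos b y < box_pos b x).
Proof. by move=> y x z xy yz; apply: ltn_trans yz xy. Qed.

Lemma sorted_reading_order (n : nat) (b : bool) :
  sorted (fun x y => box_pos b y < box_pos b x) (reading_order n b).
Proof.
have enum_lt m : pairwise (fun i j : 'I_m => i < j) (enum 'I_m).
  have := iota_ltn_sorted 0 m; rewrite -val_enum_ord sorted_pairwise ?pairwise_map //.
  exact: ltn_trans.
rewrite (sorted_pairwise (@box_pos_gt_trans n b)) !pairwise_cat; apply/and3P; split.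
- apply/allrelP => _ y /mapP[i _ ->]; rewrite mem_cat => /orP[|/mapP[j _ ->]] /=.
    by case: b; rewrite !inE => /orP[] /eqP-> /=; have := ltn_ord i; lia.
  by have := ltn_ord i; have := ltn_ord j; lia.
- rewrite pairwise_map; apply: sub_pairwise (enum_lt _) => i j /= ij.
  by have := ltn_ord i; have := ltn_ord j; lia.
apply/and3P; split.
- apply/allrelP => x _ + /mapP[j _ ->] /=.
  by case: b; rewrite !inE => /orP[] /eqP-> /=; have := ltn_ord j; lia.
- by case: b => /=; lia.
rewrite pairwise_map -sorted_pairwise; last by move=> j i k /= h1 h2; lia.
by rewrite rev_sorted sorted_pairwise // => j i k; apply: ltn_trans.
Qed.

(** Both lists are strictly decreasing for [box_pos b] and have the same members. *)
Lemma linear_extension_reading (n : nat) (O : {set box n}) (e : seq (boxes_of O)) :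
  linear_extension e ->
  exists b, map val (rev e) = [seq x <- reading_order n b | x \in O].
Proof.
case=> e_uniq e_all e_lt.
(* [b] is set when [e] lists [MidB] before [MidA], so that [rev e] reads [MidA] first. *)
pose b := [exists x : boxes_of O, [exists y : boxes_of O,
  [&& val x == MidA, val y == MidB & index y e < index x e]]].
have e_pos (x y : boxes_of O) :
    box_pos b (val x) < box_pos b (val y) -> index x e < index y e.
  case/box_pos_ltQ; first exact: e_lt.
  case: (boolP b) => [/existsP[u /existsP[w /and3P[/eqP uA /eqP wB uw]]] [xB yA]|].
    have -> : x = w by apply: val_inj; rewrite xB wB.
    by have -> : y = u by apply: val_inj; rewrite yA uA.
  move=> nb [xA yB]; rewrite ltn_neqAle; apply/andP; split.
    apply/eqP => /(index_inj x (e_all x) (e_all y)) E.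
    by move: xA; rewrite E yB.
  rewrite leqNgt; apply: contra nb => lt_yx.
  by apply/existsP; exists x; apply/existsP; exists y; rewrite xA yB !eqxx.
exists b; apply: (irr_sorted_eq (@box_pos_gt_trans n b)).
- by move=> x; rewrite ltnn.
- rewrite map_rev rev_sorted sorted_map sorted_pairwise; last first.
    by move=> y x z /= xy yz; apply: ltn_trans xy yz.
  case: e e_uniq e_all e_lt b e_pos => // x0 e e_uniq e_all _ b e_pos.
  apply/(pairwiseP x0) => i j; rewrite !inE => i_lt j_lt ij /=.
  rewrite ltn_neqAle leqNgt; apply/andP; split.
    apply/eqP => /box_pos_inj/val_inj/eqP; rewrite nth_uniq //; lia.
  by apply/negP => /e_pos; rewrite !index_uniq //; lia.
- apply: sorted_filter; first exact: box_pos_gt_trans.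
  exact: sorted_reading_order.
move=> x; rewrite mem_filter mem_reading_order andbT.
apply/mapP/idP => [[y _ ->]|xO]; first exact: valP.
by exists (Sub x xO); rewrite ?mem_rev.
Qed.

Lemma take_index_filter (T : eqType) (P : pred T) (x : T) (s : seq T) : P x ->
  take (index x [seq y <- s | P y]) [seq y <- s | P y] =
  [seq y <- take (index x s) s | P y].
Proof.
move=> Px; elim: s => //= y s IHs; case: (eqVneq y x) => [->|yx].
  by rewrite Px /= eqxx.
by case: ifP => Py /=; rewrite ?(negPf yx) ?Py /= IHs.
Qed.

Lemma take_index_uniq (T : eqType) (x : T) (p s : seq T) : uniq (p ++ x :: s) ->
  take (index x (p ++ x :: s)) (p ++ x :: s) = p.
Proof.
rewrite cat_uniq /= negb_or => /and3P[_ /andP[xp _] _].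
by rewrite index_cat (negPf xp) /= eqxx addn0 take_size_cat.
Qed.

(** * Diagrams extended to Q, and the defining condition box by box *)

Definition is_zero (a : entry) : bool := if a is Zero then true else false.

(** Boxes outside [O] count as +, so that their factor is 1. *)
Definition zero_at (n : nat) (O : {set box n}) (D : oplus_diagram O) (x : box n) : bool :=
  if insub x is Some y then is_zero (D y) else false.

Lemma zero_at_val (n : nat) (O : {set box n}) (D : oplus_diagram O) (x : boxes_of O) :
  zero_at D (val x) = is_zero (D x).
Proof. by rewrite /zero_at valK. Qed.

Lemma zero_at_mem (n : nat) (O : {set box n}) (D : oplus_diagram O) (x : box n) :
  zero_at D x -> x \in O.
Proof. by rewrite /zero_at; case: insubP. Qed.

Definition box_word (n : nat) (O : {set box n}) (D : oplus_diagram O) (s : seq (box n)) :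
    {perm signed_point n} :=
  \prod_(x <- s) factor n (label x) (zero_at D x).

(** Replaces the position k by the box read there. *)
Lemma gamma_diagram_index (n : nat) (O : {set box n}) (D : oplus_diagram O)
    (e : seq (boxes_of O)) : uniq e -> (forall x, x \in e) ->
  gamma_diagram e D <->
  forall x : boxes_of O,
    let v := box_word D (map val (take (index x (rev e)) (rev e))) in
    bruhat_lt (simple_reflections n) v (v * simple_reflection n (label (val x))).
Proof.
move=> e_uniq e_all.
have partialE k : Defs.partial_product D e k = box_word D (map val (take k (rev e))).
  rewrite /Defs.partial_product /diagram_factors -map_take big_map /box_word big_map.
  by apply: eq_bigr => x _; rewrite zero_at_val /factor; case: (D x).
split=> [G x | H k k_lt].
  have x_lt : index x (rev e) < size (rev e) by rewrite index_mem mem_rev.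
  have := G (index x (rev e)); rewrite -size_rev partialE => /(_ x_lt).
  by rewrite /reading_word (nth_map x) // nth_index // mem_rev.
case: e e_uniq e_all partialE H k_lt => // x0 e e_uniq e_all partialE H k_lt.
have k_lt' : k < size (rev (x0 :: e)) by rewrite size_rev.
have := H (nth x0 (rev (x0 :: e)) k).
by rewrite index_uniq ?rev_uniq // partialE /reading_word (nth_map x0).
Qed.

(** Boxes outside [O] contribute the factor 1, so a prefix of [rev e] has the same product as the
    corresponding prefix of the reading of Q. *)
Lemma gamma_diagram_reading (n : nat) (O : {set box n}) (D : oplus_diagram O)
    (e : seq (boxes_of O)) : linear_extension e ->
  exists b, gamma_diagram e D <->
  forall x, x \in O ->
    let v := box_word D (take (index x (reading_order n b)) (reading_order n b)) in
    bruhat_lt (simple_reflections n) v (v * simple_reflection n (label x)).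
Proof.
move=> e_linear; have [e_uniq e_all _] := e_linear.
have [b eE] := linear_extension_reading e_linear; exists b.
have vE (x : boxes_of O) : box_word D (map val (take (index x (rev e)) (rev e))) =
    box_word D (take (index (val x) (reading_order n b)) (reading_order n b)).
  rewrite map_take -(index_map val_inj) eE take_index_filter ?(valP x) //.
  rewrite /box_word big_filter big_mkcond /=; apply: eq_bigr => y _.
  case: ifPn => // yO; rewrite /zero_at insubN //.
split=> [/(gamma_diagram_index D e_uniq e_all) G x xO|H].
  by have := G (Sub x xO); rewrite /= vE.
by apply/(gamma_diagram_index D e_uniq e_all) => x; rewrite /= vE; apply: H; apply: valP.
Qed.

Definition on_nat (m : nat) (f : 'I_m -> bool) (k : nat) : bool :=
  if insub k is Some i then f i else false.

Lemma on_natE (m : nat) (f : 'I_m -> bool) (i : 'I_m) : on_nat f i = f i.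
Proof. by rewrite /on_nat valK. Qed.

Lemma on_natP (m : nat) (f : 'I_m -> bool) (k : nat) :
  on_nat f k -> exists2 i : 'I_m, i = k :> nat & f i.
Proof. by rewrite /on_nat; case: insubP => // i _ ik fi; exists i. Qed.

Lemma take_enum_ord (m i : nat) : i <= m -> map val (take i (enum 'I_m)) = iota 0 i.
Proof. by move=> im; rewrite map_take val_enum_ord take_iota (minn_idPl im). Qed.

Lemma drop_enum_ord (m i : nat) : map val (drop i (enum 'I_m)) = iota i (m - i).
Proof. by rewrite map_drop val_enum_ord drop_iota. Qed.

Lemma enum_ord_split (m : nat) (i : 'I_m) :
  enum 'I_m = take i (enum 'I_m) ++ i :: drop i.+1 (enum 'I_m).
Proof.
by rewrite -{1}(cat_take_drop i (enum 'I_m)) (drop_nth i) ?size_enum_ord // nth_ord_enum.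
Qed.

Lemma label_bounds (n : nat) (x : box n) : 3 < n -> 0 < label x <= n.
Proof.
by move=> n4; case: x => [i|||i] /=; try (have := ltn_ord i); lia.
Qed.

Lemma box_word_gen (n : nat) (O : {set box n}) (D : oplus_diagram O) (s : seq (box n)) :
  3 < n -> box_word D s \in <<simple_reflections n>>.
Proof.
by move=> n4; apply: group_prod => x _; apply: factor_gen; apply: label_bounds.
Qed.

Lemma uniq_reading_order (n : nat) (b : bool) : uniq (reading_order n b).
Proof.
apply: (sorted_uniq (@box_pos_gt_trans n b)); last exact: sorted_reading_order.
by move=> x; rewrite ltnn.
Qed.

Definition upper_zero (n : nat) (O : {set box n}) (D : oplus_diagram O) : nat -> bool :=
  on_nat (fun i => zero_at D (Upper i)).

Definition lower_zero (n : nat) (O : {set box n}) (D : oplus_diagram O) : nat -> bool :=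
  on_nat (fun i => zero_at D (Lower i)).

Lemma box_word_Upper (n : nat) (O : {set box n}) (D : oplus_diagram O) (s : seq 'I_n.-2) :
  box_word D (map (@Upper n) s) =
  \prod_(k <- map val s) factor n k.+1 (upper_zero D k).
Proof.
by rewrite /box_word !big_map; apply: eq_bigr => i _; rewrite /upper_zero on_natE.
Qed.

Lemma box_word_Lower (n : nat) (O : {set box n}) (D : oplus_diagram O) (s : seq 'I_n.-2) :
  box_word D (map (@Lower n) s) =
  \prod_(k <- map val s) factor n k.+1 (lower_zero D k).
Proof.
by rewrite /box_word !big_map; apply: eq_bigr => i _; rewrite /lower_zero on_natE.
Qed.

Lemma factor_mid_comm (n : nat) (z1 z2 : bool) : 3 < n ->
  factor n n z2 * factor n n.-1 z1 = factor n n.-1 z1 * factor n n z2.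
Proof.
move=> n4; rewrite /factor; case: z1; case: z2; rewrite ?mulg1 ?mul1g //.
by symmetry; apply: simple_reflection_comm => //; lia.
Qed.

Lemma before_Upper (n : nat) (O : {set box n}) (D : oplus_diagram O) (b : bool)
    (i : 'I_n.-2) :
  box_word D (take (index (Upper i) (reading_order n b)) (reading_order n b)) =
  upper_word n (upper_zero D) 0 i.
Proof.
have := uniq_reading_order n b.
have -> : reading_order n b = map (@Upper n) (take i (enum 'I_n.-2)) ++
    Upper i :: map (@Upper n) (drop i.+1 (enum 'I_n.-2)) ++
    (if b then [:: MidA; MidB] else [:: MidB; MidA]) ++
    map (@Lower n) (rev (enum 'I_n.-2)).
  by rewrite /reading_order {1}(enum_ord_split i) map_cat -catA.
move=> /take_index_uniq->.
by rewrite box_word_Upper take_enum_ord // ltnW.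
Qed.

Lemma before_Lower (n : nat) (O : {set box n}) (D : oplus_diagram O) (b : bool)
    (i : 'I_n.-2) : 3 < n ->
  box_word D (take (index (Lower i) (reading_order n b)) (reading_order n b)) =
  upper_word n (upper_zero D) 0 i.+1 *
  nested_word n (upper_zero D) (lower_zero D) (zero_at D MidA) (zero_at D MidB)
    i.+1 (n.-2 - i.+1).
Proof.
move=> n4; have i_lt := ltn_ord i.
have := uniq_reading_order n b.
have -> : reading_order n b = (map (@Upper n) (enum 'I_n.-2) ++
    (if b then [:: MidA; MidB] else [:: MidB; MidA]) ++
    map (@Lower n) (rev (drop i.+1 (enum 'I_n.-2)))) ++
    Lower i :: map (@Lower n) (rev (take i (enum 'I_n.-2))).
  rewrite /reading_order {2}(enum_ord_split i) rev_cat rev_cons cat_rcons map_cat /=.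
  by rewrite -!catA.
move=> /take_index_uniq->; rewrite /box_word !big_cat /= -!/(box_word _ _).
rewrite box_word_Upper box_word_Lower map_rev drop_enum_ord val_enum_ord.
rewrite /nested_word -/(lower_word _ _ _ _) !mulgA; congr (_ * _).
(* Cut the upper arm after b'_(i+1); what follows is nested around the middle. *)
rewrite -{1}(subnKC i_lt) iotaD big_cat /= -!mulgA; congr (_ * (_ * _)).
(* The middle factors commute, so both reading orders give the same product. *)
by case: b; rewrite /box_word !big_cons big_nil mulg1 //= factor_mid_comm.
Qed.

(** [b] decides which middle factor is read first and thus occurs before the other box. *)
Lemma before_Mid (n : nat) (O : {set box n}) (D : oplus_diagram O) (b : bool) :
  box_word D (take (index MidA (reading_order n b)) (reading_order n b)) =
    upper_word n (upper_zero D) 0 n.-2 * factor n n (~~ b && zero_at D MidB) /\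
  box_word D (take (index MidB (reading_order n b)) (reading_order n b)) =
    upper_word n (upper_zero D) 0 n.-2 * factor n n.-1 (b && zero_at D MidA).
Proof.
have U : box_word D (map (@Upper n) (enum 'I_n.-2)) = upper_word n (upper_zero D) 0 n.-2.
  by rewrite box_word_Upper val_enum_ord.
have := uniq_reading_order n b; rewrite /reading_order.
case: b => /= u_uniq; split.
- by rewrite take_index_uniq // U mulg1.
- move: u_uniq; rewrite -cat1s catA => /take_index_uniq->.
  by rewrite /box_word big_cat big_seq1 -/(box_word _ _) U.
- move: u_uniq; rewrite -cat1s catA => /take_index_uniq->.
  by rewrite /box_word big_cat big_seq1 -/(box_word _ _) U.
by rewrite take_index_uniq // U mulg1.
Qed.

(** The tests at upper and middle boxes always succeed, by [upper_positive], [middleA_positive] and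
    [middleB_positive]; [lower_positive] turns the remaining ones into the stated condition. *)
Lemma gamma_diagram_lower (n : nat) (O : {set box n}) (D : oplus_diagram O)
    (e : seq (boxes_of O)) : 3 < n -> linear_extension e ->
  gamma_diagram e D <->
  forall (i : 'I_n.-2) (y : signed_point n), Lower i \in O ->
    coord y = i.+1 -> y.2 = false -> upper_zero D i ->
    (nested_word n (upper_zero D) (lower_zero D) (zero_at D MidA) (zero_at D MidB)
      i.+1 (n.-2 - i.+1))^-1 y != y.
Proof.
move=> n4 /(gamma_diagram_reading D)[b ->].
have bruhatE k (i j : 'I_n) v : v \in <<simple_reflections n>> ->
    i.+1 = k -> j = k :> nat ->
    bruhat_lt (simple_reflections n) v (v * simple_reflection n k) =
    (rank (v^-1 (i, false)) < rank (v^-1 (j, false))).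
  move=> vS ik jk; apply: bruhat_lt_simple => //; last by lia.
    by have := ltn_ord j; lia.
  exact: simple_reflection_lt.
have bE x : let v := box_word D (take (index x (reading_order n b)) (reading_order n b)) in
  v \in <<simple_reflections n>> by apply: box_word_gen.
have ord_ex k : k < n -> exists i : 'I_n, i = k :> nat by move=> kn; exists (Ordinal kn).
split=> [G i y iO y1 y2 Ui|H].
  have i_lt := ltn_ord i.
  have [|i' i'E] := ord_ex i; first lia.
  have := G _ iO; rewrite /= (bruhatE _ i' y.1) //; last by rewrite i'E.
  rewrite before_Lower // (@lower_positive n _ _ _ _ i) //; last by lia.
  by rewrite Ui /= (_ : (y.1, false) = y) //; case: (y) y2 => a c /= ->.
have [n1 n2] : n.-1 < n /\ n.-2 < n by lia.
case=> [i|||i] xO /=.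
- have i_lt := ltn_ord i.
  have [|i' i'E] := ord_ex i; first lia.
  have [|j' j'E] := ord_ex i.+1; first lia.
  rewrite (bruhatE _ i' j') ?i'E // before_Lower //.
  rewrite (@lower_positive n _ _ _ _ i) //; last by lia.
  by apply/negP => /andP[Ui]; apply/negP; apply: H.
- rewrite (bruhatE _ (Ordinal n2) (Ordinal n1)) //=; last by lia.
  by rewrite (before_Mid D b).1; apply: middleA_positive.
- rewrite (@bruhat_lt_simple _ _ _ (Ordinal n2) (Ordinal n1) true) //=; [|lia| |lia].
    by rewrite (before_Mid D b).2; apply: middleB_positive.
  by apply: simple_reflection_last => /=; lia.
have i_lt := ltn_ord i.
have [|i' i'E] := ord_ex i; first lia.
have [|j' j'E] := ord_ex i.+1; first lia.
by rewrite (bruhatE _ i' j') ?i'E // before_Upper; apply: upper_positive.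
Qed.

Theorem mainTheorem9 (n : nat) (n_ge4 : 4 <= n) (O : {set box n})
    (O_ideal : order_ideal O) (D : oplus_diagram O)
    (e : seq (boxes_of O)) (e_linear : linear_extension e) :
  gamma_diagram e D <->
  (forall c : boxes_of O, ltQ MidA (val c) -> ltQ MidB (val c) -> D c = Zero ->
   forall b : boxes_of O, coverQ (val b) (val c) ->
   forall b' : boxes_of O, val b' = box_conj (val b) ->
   ~ (D b = Plus /\ D b' = Plus)).
Proof.
have plusE x : D x = Plus <-> zero_at D (val x) = false.
  by rewrite zero_at_val; case: (D x).
rewrite (gamma_diagram_lower D n_ge4 e_linear); split=> [G c cA cB c0 b bc b' b'E|H].
  case=> /plusE b0; rewrite plusE b'E => b'0 {b' b'E}.
  move: (val b) bc b0 b'0 => {}b bc b0 b'0.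
  have {}c0 : zero_at D (val c) by rewrite zero_at_val c0.
  have cO := valP c; move: (val c) cA cB c0 bc cO => {c} c /ltQ_height + _.
  (* By height, a box above both middle boxes is some [Upper i]. *)
  case: c => [i|||i] /=; try (by have := ltn_ord i; lia); try (by lia).
  have i_lt := ltn_ord i; move=> _ Ui bc UO.
  (* The failure will show at the conjugate [Lower i], which the ideal contains along with
     [Upper i]. *)
  have LO : Lower i \in O.
    apply: O_ideal UO.
    exact: connect_trans (leQ_Lower_Mid i).1 (leQ_Mid_Upper i).1.
  have i1_lt : i.+1 < n by lia.
  have := G i (Ordinal i1_lt, false) LO erefl erefl.
  rewrite /upper_zero on_natE => /(_ Ui)/eqP; apply.
  have ik : i.+1 + (n.-2 - i.+1) = n.-2 by lia.
  (* The pair [b], [box_conj b] is the outermost pair of the nested word: the boxes indexed [i.+1],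
     or the middle boxes when [i.+1 = n.-2]. *)
  apply: nested_word_plus => //.
    move=> m0; case: b bc b0 b'0 => [j|||j] //=; try (by move=> /eqP; lia).
    move=> ji b0 b'0; have {}ji : j = i.+1 :> nat by apply/eqP.
    by rewrite /upper_zero /lower_zero -ji !on_natE b0 b'0.
  move=> m0; case: b bc b0 b'0 => [j|||j] //=; last by have := ltn_ord j; lia.
    by move=> _ -> ->.
  by move=> _ -> ->.
have upO (i : 'I_n.-2) x : Upper i \in O -> leQ x (Upper i) -> x \in O.
  by move=> iO xi; apply: O_ideal iO.
(* Restates [H] in terms of [zero_at]: the ideal contains [Upper i], hence also [b] and its
   conjugate. *)
have cond (i : 'I_n.-2) (b : box n) : zero_at D (Upper i) -> coverQ b (Upper i) ->
    zero_at D b || zero_at D (box_conj b).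
  move=> Ui bc; have iO := zero_at_mem Ui.
  have [lA lB] := leQ_Mid_Upper i.
  have [tA tB] : ltQ MidA (Upper i) /\ ltQ MidB (Upper i) by rewrite /ltQ lA lB.
  have bO : b \in O by apply: upO iO _; apply: connect1.
  have b'O : box_conj b \in O by apply: upO iO _; apply: box_conj_leQ.
  have i0 : D (Sub (Upper i) iO) = Zero.
    move: Ui; rewrite -[Upper i]/(val (Sub (Upper i) iO : boxes_of O)) zero_at_val.
    by case: (D _).
  have := H (Sub (Upper i) iO) tA tB i0 (Sub b bO) bc (Sub (box_conj b) b'O) erefl.
  rewrite !plusE /=; case: (zero_at D b) => //; case: (zero_at D _) => //.
  by move=> h; case: h.
(* [condS] and [condM] are the two quantified premises of [nested_word_move]; applied to [Ui], they
   also give its last premise. *)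
have condS j : j.+1 < n.-2 -> upper_zero D j -> upper_zero D j.+1 || lower_zero D j.+1.
  move=> j_lt /on_natP[i ij Ui]; rewrite /upper_zero /lower_zero.
  rewrite -[j.+1]/(val (Ordinal j_lt)) !on_natE.
  by apply: cond Ui _ => /=; rewrite ij.
have condM j : j.+1 = n.-2 -> upper_zero D j -> zero_at D MidA || zero_at D MidB.
  by move=> jn /on_natP[i ij Ui]; apply: (cond i MidA) => //=; rewrite ij jn.
move=> i y LO y1 y2 Ui; have i_lt := ltn_ord i.
apply: nested_word_move => //; [lia|by move=> j _; apply: condS|by move=> j _; apply: condM|].
by case: eqP => m0; [apply: condM Ui|apply: condS Ui]; lia.
Qed.
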